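(* Let $p$ be a prime number, let $d_1,d_2$ be two positive odd integers, and let $G$ be the pro-$p$ group with pro-$p$ presentation $$G=\langle\, x,y_1,\ldots,y_{d_1},z_1,\ldots,z_{d_2}\ \mid\ r_1=r_2=1\,\rangle,$$ where either (1.1.a) $d_1+d_2\geq 4$ and $$r_1=[x,y_1][y_2,y_3]\cdots[y_{d_1-1},y_{d_1}],\qquad r_2=[x,z_1][z_2,z_3]\cdots[z_{d_2-1},z_{d_2}];$$ or (1.1.b) $p$ is odd and $$r_1=y_1^p[y_1,x][y_2,y_3]\cdots[y_{d_1-1},y_{d_1}],\qquad r_2=z_1^p[z_1,x][z_2,z_3]\cdots[z_{d_2-1},z_{d_2}].$$ Then there is no orientation $\theta\colon G\to 1+p\mathbb{Z}_p$ such that the oriented pro-$p$ group $(G,\theta)$ is 1-cyclotomic.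
   Context: Commutators are $[h,g]=h^{-1}g^{-1}hg$. If $d_1=1$ (resp. $d_2=1$), the product $[y_2,y_3]\cdots[y_{d_1-1},y_{d_1}]$ (resp. $[z_2,z_3]\cdots[z_{d_2-1},z_{d_2}]$) is empty. Generators and presentations of pro-$p$ groups are meant in the topological sense, and subgroups are closed. $1+p\mathbb{Z}_p=\{1+p\lambda\mid\lambda\in\mathbb{Z}_p\}$ is the (multiplicative) group of principal units of $\mathbb{Z}_p$. An oriented pro-$p$ group is a pair $(G,\theta)$ with $G$ a pro-$p$ group and $\theta\colon G\to 1+p\mathbb{Z}_p$ a continuous homomorphism, called an orientation. $\mathbb{Z}_p(\theta)$ denotes the continuous $G$-module equal to $\mathbb{Z}_p$ as an abelian pro-$p$ group, with action $g\cdot\lambda=\theta(g)\lambda$. $(G,\theta)$ is Kummerian if for every $n\geq1$ the natural map $\mathrm{H}^1(G,\mathbb{Z}_p(\theta)/p^n\mathbb{Z}_p(\theta))\to\mathrm{H}^1(G,\mathbb{Z}/p\mathbb{Z})$ induced by the epimorphism of $G$-modules $\mathbb{Z}_p(\theta)/p^n\mathbb{Z}_p(\theta)\to\mathbb{Z}/p$ (with $\mathbb{Z}/p$ a trivial module) is surjective. $(G,\theta)$ is 1-cyclotomic if $(H,\theta|_H)$ is Kummerian for every closed subgroup $H$ of $G$. *)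

(* Defs.v *)
From HB Require Import structures.
From mathcomp Require Import all_boot all_order all_algebra.
From mathcomp Require Import all_classical topology.

Set Implicit Arguments.
Unset Strict Implicit.
Unset Printing Implicit Defensive.

Import Order.TTheory GRing.Theory Num.Theory.

Local Open Scope classical_set_scope.

HB.mixin Record isTopologicalGroup G of Group G & Topological G := {
  mulg_continuous : continuous (fun z : G * G => (z.1 * z.2)%g);
  invg_continuous : continuous (fun x : G => x^-1%g)
}.

#[short(type="topGroupType")]
HB.structure Definition TopologicalGroup :=
  {G of Group G & Topological G & isTopologicalGroup G}.

Record subgroup (G : groupType) := Subgroup {
  carrier :> set G;
  carrier1 : carrier 1%g;
  carrierM : forall x y, carrier x -> carrier y -> carrier (x * y)%g;
  carrierV : forall x, carrier x -> carrier x^-1%g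
}.

Definition normal_subgroup (G : groupType) (N : subgroup G) :=
  forall x g : G, carrier N x -> carrier N (x ^ g)%g.

Section SubgroupAsGroup.
Variables (G : topGroupType) (H : subgroup G).
Implicit Types x y z : set_type (carrier H).

Lemma carrier_val x : carrier H (set_val x).
Proof. exact: set_valP. Qed.

Definition sg_one : set_type (carrier H) := SigSub (mem_set (carrier1 H)).
Definition sg_mul x y : set_type (carrier H) :=
  SigSub (mem_set (carrierM (carrier_val x) (carrier_val y))).
Definition sg_inv x : set_type (carrier H) :=
  SigSub (mem_set (carrierV (carrier_val x))).

Lemma sg_mulA : associative sg_mul.
Proof. by move=> x y z; apply: val_inj; rewrite /= mulgA. Qed.
Lemma sg_mul1 : left_id sg_one sg_mul.
Proof. by move=> x; apply: val_inj; rewrite /= mul1g. Qed.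
Lemma sg_mulr1 : right_id sg_one sg_mul.
Proof. by move=> x; apply: val_inj; rewrite /= mulg1. Qed.
Lemma sg_mulV : left_inverse sg_one sg_inv sg_mul.
Proof. by move=> x; apply: val_inj; rewrite /= mulVg. Qed.
Lemma sg_mulrV : right_inverse sg_one sg_inv sg_mul.
Proof. by move=> x; apply: val_inj; rewrite /= mulgV. Qed.

HB.instance Definition _ := isGroup.Build (set_type (carrier H))
  sg_mulA sg_mul1 sg_mulr1 sg_mulV sg_mulrV.


Lemma sg_mul_continuous : continuous
  (fun z : set_type (carrier H) * set_type (carrier H) => (z.1 * z.2)%g).
Proof.
apply: continuous_comp_initial => z.
apply: (@continuous_comp _ _ _
  (fun z : set_type (carrier H) * set_type (carrier H) =>
     (set_val z.1, set_val z.2)) (fun z : G * G => (z.1 * z.2)%g)).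
  apply: cvg_pair => /=.
    apply: (@cvg_comp _ _ _ fst set_val); first exact: cvg_fst.
    exact: initial_continuous.
  apply: (@cvg_comp _ _ _ snd set_val); first exact: cvg_snd.
  exact: initial_continuous.
exact: mulg_continuous.
Qed.

Lemma sg_inv_continuous :
  continuous (fun x : set_type (carrier H) => x^-1%g).
Proof.
apply: continuous_comp_initial => x.
apply: (@continuous_comp _ _ _ set_val (fun x : G => x^-1%g)).
  exact: initial_continuous.
exact: invg_continuous.
Qed.

HB.instance Definition _ := isTopologicalGroup.Build (set_type (carrier H))
  sg_mul_continuous sg_inv_continuous.

End SubgroupAsGroup.


Definition is_pro_p (p : nat) (G : topGroupType) : Prop :=
  [/\ compact [set: G], hausdorff_space G, totally_disconnected [set: G]
    & forall N : subgroup G, open N -> normal_subgroup N ->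
        exists k, (range (fun x : G => [set (x * n)%g | n in carrier N])
          #= `I_(p ^ k))%card].

Definition continuous_hom (G H : topGroupType) (f : G -> H) : Prop :=
  continuous f /\ {morph f : x y / (x * y)%g}.

Definition is_free_pro_p (p : nat) (X : finType) (F : topGroupType)
    (b : X -> F) : Prop :=
  is_pro_p p F /\
  forall (H : topGroupType) (f : X -> H), is_pro_p p H ->
    exists! phi : F -> H, continuous_hom phi /\ forall i, phi (b i) = f i.

(* [rels F b] is the set of relators, as words in the elements [b i] of [F];
   the kernel of [pi] is the closed normal subgroup they generate *)
Definition has_pro_p_presentation (p : nat) (X : finType)
    (rels : forall F : groupType, (X -> F) -> set F) (G : topGroupType) :
    Prop :=
  is_pro_p p G /\
  exists (F : topGroupType) (b : X -> F) (pi : F -> G),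
    [/\ is_free_pro_p p b, continuous_hom pi, range pi = [set: G]
      & forall w, pi w = 1%g <->
          forall N : subgroup F, closed N -> normal_subgroup N ->
            rels F b `<=` N -> carrier N w].

(* [y] lists y_1, ..., y_d, so that y_i is [y`_i.-1] *)

Section Relators.
Local Open Scope group_scope.

Definition commutator_tail (F : groupType) (y : seq F) : F :=
  \prod_(0 <= i < (size y)./2) [~ y`_i.*2.+1, y`_i.*2.+2].

Definition relator_a (F : groupType) (x : F) (y : seq F) : F :=
  [~ x, y`_0] * commutator_tail y.

Definition relator_b (p : nat) (F : groupType) (x : F) (y : seq F) : F :=
  y`_0 ^+ p * [~ y`_0, x] * commutator_tail y.

Definition gens (d1 d2 : nat) : finType := option ('I_d1 + 'I_d2)%type.

Section Generators.
Variables (p d1 d2 : nat) (F : groupType) (b : gens d1 d2 -> F).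

Definition xgen : F := b None.
Definition ygens : seq F := [seq b (Some (inl i)) | i <- enum 'I_d1].
Definition zgens : seq F := [seq b (Some (inr i)) | i <- enum 'I_d2].

Definition relators_a : set F :=
  [set relator_a xgen ygens; relator_a xgen zgens]%classic.

Definition relators_b : set F :=
  [set relator_b p xgen ygens; relator_b p xgen zgens]%classic.

End Generators.
End Relators.

Arguments relators_a d1 d2 F b : clear implicits.
Arguments relators_b p d1 d2 F b : clear implicits.

(* Coherent sequences of residues, the n-th term being the
   representative of a residue class mod p^n in [0, p^n[.  (The
   name Zp is taken in the library by the additive group of 'Z_p) *)

Local Open Scope ring_scope.

Definition pexp (p n : nat) : int := ((p ^ n)%N)%:Z.

Record padic (p : nat) := MkPadic {
  res :> nat -> int;
  res_coherent : forall n, res n = (res n.+1 %% pexp p n)%Z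
}.

HB.instance Definition _ p := gen_eqMixin (padic p).
HB.instance Definition _ p := gen_choiceMixin (padic p).

Section PadicRing.
Variable p : nat.
Implicit Types a b c : padic p.

Lemma padic_ext a b : (forall n, a n = b n) -> a = b.
Proof.
case: a b => [a ha] [b hb] /= /funext ab; rewrite -{}ab in hb *.
by congr MkPadic; apply: Prop_irrelevance.
Qed.

Lemma modz_pexp n k (m : int) :
  ((m %% pexp p (k + n))%Z %% pexp p n)%Z = (m %% pexp p n)%Z.
Proof.
rewrite [in RHS](divz_eq m (pexp p (k + n))).
have -> : pexp p (k + n) = pexp p k * pexp p n by rewrite /pexp expnD PoszM.
by rewrite mulrA modzMDl.
Qed.

Lemma res_mod a n : (a n %% pexp p n)%Z = a n.
Proof. by rewrite [in LHS]res_coherent modz_mod -res_coherent. Qed.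

Lemma res_modn a k n : (a (k + n)%N %% pexp p n)%Z = a n.
Proof.
elim: k => [|k IH]; first by rewrite res_mod.
by rewrite -IH [in RHS]res_coherent modz_pexp.
Qed.

Definition padic_int_subproof (m : int) n :
  (m %% pexp p n)%Z = ((m %% pexp p n.+1)%Z %% pexp p n)%Z.
Proof. by rewrite (modz_pexp _ 1). Qed.
Definition padic_int (m : int) : padic p := MkPadic (padic_int_subproof m).

Lemma padic_add_subproof a b n : ((a n + b n) %% pexp p n)%Z =
  (((a n.+1 + b n.+1) %% pexp p n.+1)%Z %% pexp p n)%Z.
Proof. by rewrite (modz_pexp _ 1) -[RHS]modzDm -!res_coherent. Qed.
Definition padic_add a b : padic p := MkPadic (padic_add_subproof a b).

Lemma padic_opp_subproof a n : (- a n %% pexp p n)%Z =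
  ((- a n.+1 %% pexp p n.+1)%Z %% pexp p n)%Z.
Proof. by rewrite (modz_pexp _ 1) -[RHS]modzNm -res_coherent. Qed.
Definition padic_opp a : padic p := MkPadic (padic_opp_subproof a).

Lemma padic_mul_subproof a b n : ((a n * b n) %% pexp p n)%Z =
  (((a n.+1 * b n.+1) %% pexp p n.+1)%Z %% pexp p n)%Z.
Proof. by rewrite (modz_pexp _ 1) -[RHS]modzMm -!res_coherent. Qed.
Definition padic_mul a b : padic p := MkPadic (padic_mul_subproof a b).

Lemma padic_addA : associative padic_add.
Proof. by move=> a b c; apply: padic_ext => n /=; rewrite modzDml modzDmr addrA. Qed.
Lemma padic_addC : commutative padic_add.
Proof. by move=> a b; apply: padic_ext => n /=; rewrite addrC. Qed.
Lemma padic_add0 : left_id (padic_int 0) padic_add.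
Proof. by move=> a; apply: padic_ext => n /=; rewrite modzDml add0r res_mod. Qed.
Lemma padic_addN : left_inverse (padic_int 0) padic_opp padic_add.
Proof. by move=> a; apply: padic_ext => n /=; rewrite modzDml addNr. Qed.

HB.instance Definition _ := GRing.isZmodule.Build (padic p)
  padic_addA padic_addC padic_add0 padic_addN.

Lemma padic_mulA : associative padic_mul.
Proof. by move=> a b c; apply: padic_ext => n /=; rewrite modzMml modzMmr mulrA. Qed.
Lemma padic_mulC : commutative padic_mul.
Proof. by move=> a b; apply: padic_ext => n /=; rewrite mulrC. Qed.
Lemma padic_mul1 : left_id (padic_int 1) padic_mul.
Proof. by move=> a; apply: padic_ext => n /=; rewrite modzMml mul1r res_mod. Qed.
Lemma padic_mulDl : left_distributive padic_mul +%R.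
Proof.
by move=> a b c; apply: padic_ext => n /=; rewrite modzMml modzDm mulrDl.
Qed.

HB.instance Definition _ := GRing.Zmodule_isComPzRing.Build (padic p)
  padic_mulA padic_mulC padic_mul1 padic_mulDl.

Lemma res_natr m n : (m%:R : padic p) n = (m%:Z %% pexp p n)%Z.
Proof.
elim: m => [|m IH] //; rewrite -addn1 natrD [LHS]/= IH modzDm.
by rewrite PoszD.
Qed.

(* the p-adic topology: the cosets a + p^n Z_p are a basis at a *)

Definition padic_nbhs a : set_system (padic p) :=
  filter_from [set: nat] (fun n => [set b : padic p | b n = a n]).

HB.instance Definition _ := hasNbhs.Build (padic p) padic_nbhs.

Lemma res_le a b m n : (m <= n)%N -> a n = b n -> a m = b m.
Proof.
move=> /subnK <-; elim: (n - m)%N => [|k IH] //=; rewrite addSn => h.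
by apply: IH; rewrite res_coherent h -res_coherent.
Qed.

Lemma padic_nbhs_filter a : ProperFilter (nbhs a).
Proof.
apply: filter_from_proper; last by move=> n _; exists a.
apply: filter_from_filter; first by exists 0%N.
move=> m n _ _; exists (maxn m n) => // b /= ab; split => /=.
  by apply: res_le ab; rewrite leq_maxl.
by apply: res_le ab; rewrite leq_maxr.
Qed.

Lemma padic_nbhs_singleton a (A : set (padic p)) : nbhs a A -> A a.
Proof. by move=> [n _]; apply. Qed.

Lemma padic_nbhs_nbhs a (A : set (padic p)) : nbhs a A -> nbhs a (nbhs^~ A).
Proof.
move=> [n _ nA]; exists n => // b /= ba; exists n => // c /= cb.
by apply: nA; rewrite /= cb.
Qed.

HB.instance Definition _ := Nbhs_isNbhsTopological.Build (padic p)
  padic_nbhs_filter padic_nbhs_singleton padic_nbhs_nbhs.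

End PadicRing.
Definition principal_units (p : nat) : set (padic p) :=
  range (fun l : padic p => 1 + p%:R * l).
Arguments principal_units : clear implicits.

Record orientation (p : nat) (G : topGroupType) := Orientation {
  orient :> G -> padic p;
  orient_continuous : continuous orient;
  orientM : forall g h, orient (g * h)%g = orient g * orient h;
  orient_unit : forall g, principal_units p (orient g)
}.

Section Restriction.
Variables (p : nat) (G : topGroupType) (theta : orientation p G).
Variable H : subgroup G.

Let res_theta (g : set_type H) : padic p := theta (set_val g).

Lemma orient_res_continuous : continuous res_theta.
Proof.
move=> g; apply: (@continuous_comp _ _ _ set_val theta).
  exact: initial_continuous.
exact: orient_continuous.
Qed.

Lemma orient_resM (g h : set_type H) :
  res_theta (g * h)%g = res_theta g * res_theta h.
Proof. exact: orientM. Qed.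

Lemma orient_res_unit g : principal_units p (res_theta g).
Proof. exact: orient_unit. Qed.

Definition orient_restrict : orientation p (set_type H) :=
  Orientation orient_res_continuous orient_resM orient_res_unit.

End Restriction.

(* Coefficients carry the discrete topology; cohomology classes are the cosets
   of the coboundaries in the group of continuous cocycles *)

Section Cohomology.
Variable G : topGroupType.

Section Module.
Variables (M : zmodType) (act : G -> M -> M).

Definition cocycle (c : G -> M) : Prop :=
  continuous (c : G -> discrete_topology M) /\
  forall g h, c (g * h)%g = c g + act g (c h).

Definition coboundary (c : G -> M) : Prop :=
  exists m, forall g, c g = act g m - m.

Definition cohomology_class (c : G -> M) : set (G -> M) :=
  [set c' | cocycle c' /\ coboundary (fun g => c' g - c g)].

Definition H1 : set (set (G -> M)) :=
  [set cohomology_class c | c in cocycle].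

End Module.

Variables (M N : zmodType) (actM : G -> M -> M) (actN : G -> N -> N).

(* the image of a class is the class of f o c, for any c in the class *)
Definition H1_map (f : M -> N) (A : set (G -> M)) : set (G -> N) :=
  \bigcup_(c in A) cohomology_class actN (f \o c).

Lemma H1_mapE (f : M -> N) (c : G -> M) :
  (forall g, {morph actM g : u v / u + v}) ->
  (forall g, {morph actN g : u v / u + v}) -> {morph f : u v / u + v} ->
  (forall g, {morph f : u / actM g u >-> actN g u}) -> cocycle actM c ->
  H1_map f (cohomology_class actM c) = cohomology_class actN (f \o c).
Proof.
move=> actMD actND fD fact cc.
have fB u v : f (u - v) = f u - f v.
  by apply: (addIr (f v)); rewrite -fD !subrK.
apply/seteqP; split => [c' [c1 [_ [m cm]] [c'c [k ck]]]|c' c'c].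
  split => //; exists (k + f m) => g.
  have := congr1 f (cm g); rewrite !fB fact => fcm.
  rewrite actND opprD addrACA -ck -fcm /=.
  by rewrite addrA subrK.
exists c => //; split => //; exists 0 => g.
by rewrite subrr subr0; apply: (addIr (actM g 0)); rewrite -actMD !add0r.
Qed.

End Cohomology.

(* Z_p(theta)/p^n Z_p(theta) is carried by 'Z_(p ^ n) through the reduction map
   [padic_red]; see [padic_red_surj] and [padic_red_ker].  For n = 0 the type
   'Z_(p ^ n) is not the zero ring, so only n > 0 is meaningful *)

Definition padic_red (p n : nat) (a : padic p) : 'Z_(p ^ n) := (a n)%:~R.

Definition twist_act (p : nat) (G : topGroupType) (theta : orientation p G)
    (n : nat) (g : G) (m : 'Z_(p ^ n)) : 'Z_(p ^ n) :=
  padic_red n (theta g) * m.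

Definition trivial_act (G : topGroupType) (M : zmodType) (g : G) (m : M) : M :=
  m.

Definition mod_p (p n : nat) (m : 'Z_(p ^ n)) : 'F_p := (m : nat)%:R.

Section Reduction.
Variables (p n : nat).
Hypotheses (p_gt1 : (1 < p)%N) (n_gt0 : (0 < n)%N).

Let pn_gt1 : (1 < p ^ n)%N.
Proof. by rewrite -(exp1n n) ltn_exp2r. Qed.

Lemma intr_modz (m : int) : (m %% pexp p n)%Z%:~R = m%:~R :> 'Z_(p ^ n).
Proof.
rewrite [in RHS](divz_eq m (pexp p n)) [RHS]rmorphD [X in _ = X + _]rmorphM /=.
by rewrite [X in _ * X + _](pchar_Zp pn_gt1) mulr0 add0r.
Qed.

Lemma padic_redD : {morph @padic_red p n : a b / a + b}.
Proof. by move=> a b; rewrite /padic_red intr_modz rmorphD. Qed.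

Lemma padic_redM : {morph @padic_red p n : a b / a * b}.
Proof. by move=> a b; rewrite /padic_red intr_modz rmorphM. Qed.

Lemma padic_red1 : @padic_red p n 1 = 1.
Proof. by rewrite /padic_red intr_modz. Qed.

Lemma padic_red_surj (m : 'Z_(p ^ n)) : exists a : padic p, padic_red n a = m.
Proof.
exists (padic_int p (m : nat)%:Z); rewrite /padic_red intr_modz.
exact: natr_Zp.
Qed.

Lemma padic_red_eq0 (a : padic p) : padic_red n a = 0 <-> a n = 0.
Proof.
split => [|a0]; last by rewrite /padic_red a0.
have pn0 : pexp p n != 0 by rewrite /pexp; case: (p ^ n)%N pn_gt1.
have := modz_ge0 (a n) pn0; have := ltz_mod (a n) pn0.
rewrite /padic_red res_mod; case: (a n) => // k.
rewrite ltz_nat => kn _ /(congr1 (@nat_of_ord _)).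
by rewrite /= [X in nat_of_ord X]/(k%:R) val_Zp_nat // modn_small // => ->.
Qed.

Lemma padic_red_ker (a : padic p) :
  padic_red n a = 0 <-> exists b, a = (p ^ n)%:R * b.
Proof.
have pn_gt0 : 0 < pexp p n by rewrite ltz_nat ltnW.
split=> [/padic_red_eq0 a0|[b ->]]; last first.
  rewrite padic_redM [X in X * _]/padic_red res_natr intr_modz.
  by rewrite [X in X * _](pchar_Zp pn_gt1) mul0r.
have aE k : a (k + n)%N = pexp p n * (a (k + n)%N %/ pexp p n)%Z.
  by rewrite {1}(divz_eq (a (k + n)%N) (pexp p n)) res_modn a0 addr0 mulrC.
have bP k : (a (k + n)%N %/ pexp p n)%Z =
    ((a (k.+1 + n)%N %/ pexp p n)%Z %% pexp p k)%Z.
  apply: (mulfI (lt0r_neq0 pn_gt0)); rewrite -aE res_coherent -addSn.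
  rewrite {1}aE {1}/modz [in RHS]/modz.
  have -> : pexp p (k + n) = pexp p n * pexp p k.
    by rewrite /pexp addnC expnD PoszM.
  by rewrite divzMpl // mulrBr mulrCA.
exists (MkPadic bP); apply: padic_ext => k.
by rewrite [RHS]/= res_natr modzMml -aE addnC res_modn.
Qed.

End Reduction.

Section CoefficientModules.
Variables (p n : nat) (G : topGroupType) (theta : orientation p G).
Hypotheses (p_pr : prime p) (n_gt0 : (0 < n)%N).

Let p_gt1 := prime_gt1 p_pr.

Let pn_gt1 : (1 < p ^ n)%N.
Proof. by rewrite -(exp1n n) ltn_exp2r. Qed.

Lemma twist_actD g : {morph @twist_act p G theta n g : u v / u + v}.
Proof. by move=> u v; rewrite /twist_act mulrDr. Qed.

Lemma twist_actM g h (m : 'Z_(p ^ n)) :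
  twist_act theta (g * h)%g m = twist_act theta g (twist_act theta h m).
Proof. by rewrite /twist_act orientM padic_redM // mulrA. Qed.

Lemma twist_act1 (m : 'Z_(p ^ n)) : twist_act theta 1%g m = m.
Proof.
rewrite /twist_act; set e := padic_red n _.
have ee : e * e = e by rewrite -padic_redM // -orientM mulg1.
suff -> : e = 1 by rewrite mul1r.
have [l _ le] := orient_unit theta 1%g.
have eE : e - 1 = p%:R * padic_red n l.
  rewrite /e -le padic_redD // padic_red1 // padic_redM // addrC addKr.
  congr (_ * _); rewrite /padic_red res_natr intr_modz //.
have idem k : (1 - e) ^+ k.+1 = 1 - e.
  elim: k => // k IH; rewrite exprS IH mulrBr mulr1 mulrBl mul1r ee.
  by rewrite subrr subr0.
apply/esym/subr0_eq; rewrite -(idem n.-1) prednK // -opprB eE exprNn exprMn.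
by rewrite -natrX (pchar_Zp pn_gt1) mul0r mulr0.
Qed.

Lemma natr_modpX m : (m %% p ^ n)%N%:R = m%:R :> 'F_p.
Proof.
rewrite [in RHS](divn_eq m (p ^ n)) natrD natrM natrX pchar_Fp_0 //.
by rewrite expr0n -[n]prednK // mulr0 add0r.
Qed.

Lemma mod_p_natr m : mod_p (m%:R : 'Z_(p ^ n)) = m%:R.
Proof. by rewrite /mod_p val_Zp_nat // natr_modpX. Qed.

Lemma mod_pD : {morph @mod_p p n : u v / u + v}.
Proof.
move=> u v; rewrite -[u]natr_Zp -[v]natr_Zp -natrD !mod_p_natr.
by rewrite natrD.
Qed.

Lemma mod_pM : {morph @mod_p p n : u v / u * v}.
Proof.
move=> u v; rewrite -[u]natr_Zp -[v]natr_Zp -natrM !mod_p_natr.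
by rewrite natrM.
Qed.

Lemma mod_p_surj (m : 'F_p) : exists u : 'Z_(p ^ n), mod_p u = m.
Proof. by exists (m : nat)%:R; rewrite mod_p_natr; exact: natr_Zp. Qed.

Lemma mod_p_act g :
  {morph @mod_p p n : u / twist_act theta g u >-> trivial_act g u}.
Proof.
move=> u; rewrite /twist_act mod_pM.
have [l _ <-] := orient_unit theta g.
rewrite padic_redD // padic_red1 // padic_redM // mod_pD mod_pM.
have -> : padic_red n (p%:R : padic p) = p%:R.
  by rewrite /padic_red res_natr intr_modz.
rewrite (mod_p_natr 1) mod_p_natr pchar_Fp_0 // mul0r addr0.
by rewrite mul1r.
Qed.

End CoefficientModules.

Definition kummerian (p : nat) (G : topGroupType) (theta : orientation p G) :
    Prop :=
  forall n, (0 < n)%N ->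
    set_surj (H1 (twist_act theta (n := n)))
             (H1 (@trivial_act G 'F_p))
             (H1_map (@trivial_act G 'F_p) (@mod_p p n)).

Definition one_cyclotomic (p : nat) (G : topGroupType)
    (theta : orientation p G) : Prop :=
  forall H : subgroup G, closed H -> kummerian (orient_restrict theta H).

(* Main.v *)
Require Import Defs.
From HB Require Import structures.
From mathcomp Require Import all_boot all_fingroup all_algebra.
From mathcomp Require Import finmap all_classical topology.
From mathcomp Require Import zify ring.

(** Only the coefficients Z/p and Z/p^2 are needed. Let theta be an orientation
    that makes G 1-cyclotomic, and let tau be its reduction mod p^2.

    Since G itself is Kummerian, every homomorphism G -> F_p lifts to a cocycle
    c : G -> Z/p^2 for tau. Write tau = 1 + p lambda. A cocycle sends [g, h] to
    p (lambda(g) c(h) - lambda(h) c(g)), so a relator becomes a linear relation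
    mod p between the values of c on the generators; its coefficients are those
    of a symplectic form applied to lambda. The values of c mod p are arbitrary,
    hence all coefficients vanish: tau is 1 on every y_i and z_i, and tau(x) is 1
    in the first family and 1 + p in the second ([orientation_values]).

    Next, G maps to a Heisenberg group over F_p, whose elements are triples
    (a, b, c). On the closed normal subgroup H of G defined by b = 0 the
    coordinate c is a homomorphism to F_p; were H Kummerian, it would lift to a
    twisted cocycle f : H -> Z/p^2 ([heis_lift]). On the subgroup N of H where
    tau = 1, f is additive. There is w in N with c(w) = 1 and p f(w) = 0, which
    is absurd since f(w) lifts c(w).

    First family: w = [x, y_1], where y_2 and y_3 exist (after exchanging y and
    z if necessary) and y_2 and z_1 are chosen to agree mod N. The first
    relator gives f(w) = f(y_3^y_2) - f(y_3), so summing f over the conjugates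
    of w by y_2^i, for i < p, telescopes to f(y_3^(y_2^p)) - f(y_3) = 0. But
    each of these conjugates has the same value f(w): in the action on N modulo
    its commutators, y_2 commutes with y_1 and acts as z_1, which fixes x by
    the second relator ([symplectic_torsion]).

    Second family: modulo commutators of N the relators say y_1^x = y_1^(1-p)
    and z_1^x = z_1^(1-p), while f(u^x) = (1-p) f(u) for u in N. Applying this
    to z_1 y_1^-1 and to y_1^-1 z_1, where y_1 and z_1 agree mod N, gives the
    same value f(z_1^p) - f(y_1^p) for p f in both cases. So p f kills their
    quotient w = [y_1^-1, z_1] ([twisted_torsion]). That p is odd ensures that
    the Heisenberg group has exponent p, so that it receives the second
    family. *)

Set Implicit Arguments.
Unset Strict Implicit.
Unset Printing Implicit Defensive.

Import GRing.Theory.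

Local Open Scope classical_set_scope.

(** * Finite groups as discrete pro-p groups *)

Lemma discrete_continuous (D : discreteTopologicalType) (U : topologicalType)
  (f : D -> U) : continuous f.
Proof. by apply/continuousP => A _; exact: discrete_open. Qed.

Lemma closed_preimage_discrete (T : topologicalType)
    (D : discreteTopologicalType) (f : T -> D) A :
  continuous f -> closed (f @^-1` A).
Proof. by move=> /continuous_closedP; apply; exact: discrete_closed. Qed.

Definition discrete_group (gT : finGroupType) : Type := gT.

HB.instance Definition _ (gT : finGroupType) :=
  Group.copy (discrete_group gT) gT.
HB.instance Definition _ (gT : finGroupType) :=
  Topological.copy (discrete_group gT) (discrete_topology gT).
HB.instance Definition _ (gT : finGroupType) :=
  Discrete_ofNbhs.Build (discrete_group gT) erefl.

Lemma discrete_mulg_continuous (gT : finGroupType) : continuous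
  (fun z : discrete_group gT * discrete_group gT => (z.1 * z.2)%g).
Proof.
move=> [a b]; apply/discrete_cvg => /=.
by exists ([set a], [set b]); [split; exact: discrete_set1|case=> /= ? ? [-> ->]].
Qed.

Lemma discrete_invg_continuous (gT : finGroupType) :
  continuous (fun x : discrete_group gT => x^-1%g).
Proof. exact: discrete_continuous. Qed.

HB.instance Definition _ (gT : finGroupType) :=
  isTopologicalGroup.Build (discrete_group gT)
    (@discrete_mulg_continuous gT) (@discrete_invg_continuous gT).

Lemma card_eq_finset (T : finType) (A : {set T}) : ([set` A] #= `I_#|A|)%card.
Proof.
have -> : [set` A] = [set` [fset x in A]%fset].
  by apply/seteqP; split=> x /=; rewrite !inE.
by apply/card_eq_fsetP; rewrite card_imfset /= -?cardE.
Qed.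

(** Every subgroup of a discrete group is open, so that the cosets have to be
    counted for all of them; this is the theorem of Lagrange. *)
Lemma pgroup_pro_p (p : nat) (gT : finGroupType) : prime p ->
  p.-nat #|gT|%N -> is_pro_p p (discrete_group gT).
Proof.
move=> p_pr pG; split.
- exact/finite_compact/finite_finset.
- exact: discrete_hausdorff.
- apply: zero_dimension_totally_disconnected => x y xy.
  exists [set x]; split => //.
    by split; [exact: discrete_open|exact: discrete_closed].
  by move=> /esym/eqP; apply/negP.
- move=> N _ _.
  pose A : {set gT} := [set x | `[< carrier N x >]]%SET.
  have AE x : (x \in A) = `[< carrier N x >] by rewrite inE.
  have gA : group_set A.
    apply/group_setP; split; first by rewrite AE; apply/asboolP/carrier1.
    by move=> x y; rewrite !AE => /asboolP Nx /asboolP Ny; apply/asboolP/carrierM.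
  pose K := Group gA.
  have [k _ kE] : exists2 k, (k <= logn p #|gT|)%N & #|lcosets K finset.setT| = (p ^ k)%N.
    apply/dvdn_pfactor => //; rewrite -p_part part_pnat_id //.
    by rewrite card_lcosets -cardsT dvdn_indexg.
  exists k.
  (* the cosets as abstract sets are the finite left cosets of K *)
  have -> : range (fun x : discrete_group gT => [set (x * n)%g | n in carrier N]) =
     (fun B : {set gT} => [set` B]) @` [set` lcosets K finset.setT].
    have cE (x : gT) : [set (x * n)%g | n in carrier N] = [set` lcoset K x].
      apply/seteqP; split => y /=.
        by move=> [n Nn <-]; rewrite lcosetE mem_lcoset mulKg /= AE; apply/asboolP.
      rewrite lcosetE mem_lcoset /= AE => /asboolP Nn; exists (x^-1 * y)%g => //.
      exact: mulKVg.
    apply/seteqP; split => [_ [x _ <-]|_ [_ /= /imsetP[x _ ->] <-]].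
      exists (lcoset K x); last by rewrite -cE.
      by apply/imsetP; exists x; rewrite ?inE.
    by exists x => //; rewrite cE.
  rewrite -kE; apply: card_eq_trans (card_eq_finset _).
  apply: (@inj_card_eq _ _ [set` lcosets K finset.setT] 
    (fun B : {set gT} => [set` B])) => B C _ _ /seteqP[BC CB].
  by apply/setP => x; apply/idP/idP; [exact: BC|exact: CB].
Qed.

(** * Heisenberg groups *)

(** The triple (a, b, c) stands for the unitriangular 4 x 4 matrix with first
    row (1, a, c), last column (c, b, 1) and identity middle block. Rank two is
    what makes room for two commuting hyperbolic pairs, one for [x, y_1] and
    one for [y_2, y_3]. *)
Definition heis (R : finComNzRingType) : Type := ((R * R) * (R * R) * R)%type.

HB.instance Definition _ R := Finite.on (heis R).

Section Heisenberg.
Variable R : finComNzRingType.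
Implicit Types (g h : heis R) (u v : R * R).
Local Open Scope ring_scope.

Definition dot u v : R := u.1 * v.1 + u.2 * v.2.

Lemma dotDl u1 u2 v : dot (u1 + u2) v = dot u1 v + dot u2 v.
Proof. by rewrite /dot /=; ring. Qed.
Lemma dotDr u v1 v2 : dot u (v1 + v2) = dot u v1 + dot u v2.
Proof. by rewrite /dot /=; ring. Qed.
Lemma dot0l v : dot 0 v = 0.
Proof. by rewrite /dot /= !mul0r addr0. Qed.
Lemma dot0r u : dot u 0 = 0.
Proof. by rewrite /dot /= !mulr0 addr0. Qed.

Definition heis_one : heis R := (0, 0, 0).
Definition heis_mul g h : heis R :=
  (g.1.1 + h.1.1, g.1.2 + h.1.2, g.2 + h.2 + dot g.1.1 h.1.2).
Definition heis_inv g : heis R :=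
  (- g.1.1, - g.1.2, dot g.1.1 g.1.2 - g.2).

Lemma heis_mulA : associative heis_mul.
Proof.
move=> [[a b] c] [[a' b'] c'] [[a'' b''] c''].
rewrite /heis_mul dotDl dotDr !addrA; congr (_, _, _) => /=; ring.
Qed.

Lemma heis_mul1 : left_id heis_one heis_mul.
Proof. by case=> [[a b] c]; rewrite /heis_mul /= dot0l !add0r addr0. Qed.

Lemma heis_mulV : left_inverse heis_one heis_inv heis_mul.
Proof.
case=> [[a b] c]; rewrite /heis_mul /= !addNr /heis_one.
by congr (_, _, _); rewrite /dot /=; ring.
Qed.

HB.instance Definition _ :=
  Finite_isGroup.Build (heis R) heis_mulA heis_mul1 heis_mulV.

Lemma card_heis : #|{: heis R}| = (#|R| ^ 5)%N.
Proof. by rewrite !card_prod; ring. Qed.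

Lemma heis_mulE g h : (g * h)%g = heis_mul g h.
Proof. by []. Qed.

Lemma heis_commE g h :
  [~ g, h]%g = (0, 0, dot g.1.1 h.1.2 - dot h.1.1 g.1.2) :> heis R.
Proof.
apply: (mulgI (h * g)%g); rewrite -commgC !heis_mulE.
by rewrite /heis_mul; congr (_, _, _); rewrite /= ?addr0 1?addrC // dot0r; ring.
Qed.

Lemma heis_expE (a b : R * R) c n :
  (((a, b, c) : heis R) ^+ n)%g =
  (a *+ n, b *+ n, c *+ n + dot a b *+ 'C(n, 2)) :> heis R.
Proof.
elim: n => [|n IH]; first by rewrite !mulr0n addr0.
rewrite expgS IH heis_mulE /heis_mul /= binS bin1 !mulrS; congr (_, _, _).
have -> : dot a (b *+ n) = dot a b *+ n.
  by elim: (n) => [|k IHk]; rewrite ?dot0r // !mulrS dotDr IHk.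
by rewrite mulrnDr; ring.
Qed.

End Heisenberg.

(** * Homomorphisms out of a presented pro-p group *)

Section GroupHom.
Variables (F H : groupType) (h : F -> H).
Hypothesis hM : {morph h : u v / (u * v)%g}.

Lemma hom1 : h 1%g = 1%g.
Proof. by apply: (mulgI (h 1%g)); rewrite -hM !mulg1. Qed.

Lemma homV : {morph h : u / u^-1%g}.
Proof. by move=> u; apply: (mulgI (h u)); rewrite -hM !mulgV hom1. Qed.

Lemma homJ : {morph h : u v / (u ^ v)%g}.
Proof. by move=> u v; rewrite /conjg !hM homV. Qed.

Lemma homR : {morph h : u v / [~ u, v]%g}.
Proof. by move=> u v; rewrite /commg hM homV homJ. Qed.

Lemma homX n : {morph h : u / (u ^+ n)%g}.
Proof. by move=> u; elim: n => [|n IH]; rewrite ?hom1 // !expgS hM IH. Qed.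

Fact ker1 : (h @^-1` [set 1%g]) 1%g. Proof. exact: hom1. Qed.
Fact kerM x y : (h @^-1` [set 1%g]) x -> (h @^-1` [set 1%g]) y ->
  (h @^-1` [set 1%g]) (x * y)%g.
Proof. by move=> /= hx hy; rewrite hM hx hy mulg1. Qed.
Fact kerV x : (h @^-1` [set 1%g]) x -> (h @^-1` [set 1%g]) x^-1%g.
Proof. by move=> /= hx; rewrite homV hx invg1. Qed.

Definition ker_subgroup : subgroup F := Subgroup ker1 kerM kerV.

Lemma ker_normal : normal_subgroup ker_subgroup.
Proof. by move=> x g /= hx; rewrite homJ hx conj1g. Qed.

End GroupHom.

Section Presentation.
Variables (p : nat) (X : finType).
Variable rels : forall F : groupType, (X -> F) -> set F.
Hypothesis rels_natural : forall (F H : groupType) (h : F -> H) (b : X -> F),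
  {morph h : u v / (u * v)%g} -> rels (h \o b) = h @` rels b.

(** The universal property of a presentation. A map on generators that kills the
    relators extends to the free pro-p group, and the extension kills the closed
    normal subgroup generated by the relators because its own kernel is closed
    and normal. The factorization through G is continuous because pi, a
    continuous map from a compact to a Hausdorff space, is closed. *)
Lemma presentation_hom (G : topGroupType) :
  has_pro_p_presentation p rels G -> exists g : X -> G,
    rels g `<=` [set 1%g] /\
    forall (Q : topGroupType) (q : X -> Q), is_pro_p p Q ->
      rels q `<=` [set 1%g] ->
      exists phi : G -> Q, continuous_hom phi /\ forall i, phi (g i) = q i.
Proof.
move=> [[_ G_T2 _ _] [F [b [pi [[[F_cpct _ _ _] F_univ] [pi_cont piM] pi_surj]]]]].
move=> pi_ker; exists (pi \o b); split.
  rewrite (rels_natural b piM) => _ [w rw <-]; apply/pi_ker => N _ _; exact.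
move=> Q q Qp rq.
have [psi [[[psi_cont psiM] psib] _]] := F_univ Q q Qp.
have [_ Q_T2 _ _] := Qp.
have ker_le w : pi w = 1%g -> psi w = 1%g.
  move/pi_ker => /(_ (ker_subgroup psiM)); apply.
  - move/continuous_closedP: psi_cont; apply.
    by apply: compact_closed => //; exact: compact_set1.
  - exact: ker_normal.
  - move=> v rv /=; apply: rq; have -> : q = psi \o b by apply/funext => i /=.
    by rewrite (rels_natural b psiM); exists v.
have /choice[s sK] : forall x, exists w, pi w = x.
  by move=> x; have [w _ <-] : range pi x; [rewrite pi_surj | exists w].
have psi_s w : psi (s (pi w)) = psi w.
  have : psi (s (pi w) * w^-1)%g = 1%g.
    by apply: ker_le; rewrite piM sK -piM mulgV (hom1 piM).
  move=> /(congr1 (fun t => t * psi w)%g); rewrite mul1g -psiM => <-.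
  by rewrite mulgKV.
exists (psi \o s); split; last by move=> i /=; rewrite psi_s.
split; last first.
  by move=> x y /=; rewrite -psiM -(psi_s (s x * s y)%g) piM !sK.
apply/continuous_closedP => C C_closed.
have -> : (psi \o s) @^-1` C = pi @` (psi @^-1` C).
  apply/seteqP; split => [x /= Cx|_ [w /= Cw <-]]; last by rewrite /= psi_s.
  by exists (s x).
apply: compact_closed => //; apply: continuous_compact.
  exact: continuous_subspaceT.
apply: subclosed_compact F_cpct _ => //.
by move/continuous_closedP: psi_cont; apply.
Qed.

End Presentation.

(** * Torsion forced by the relators *)

(** The setting: f is additive on a normal subgroup N. It is invariant under
    conjugation by N but not by G, and the interplay of the G-conjugates of f is
    what produces torsion. *)
Section AdditiveOnNormal.
Variables (G : groupType) (N : subgroup G) (A : zmodType) (f : G -> A).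
Hypothesis nN : normal_subgroup N.
Hypothesis fM : forall u v, carrier N u -> carrier N v ->
  f (u * v)%g = (f u + f v)%R.
Local Open Scope group_scope.
Implicit Types u v g : G.

Lemma add_on1 : f 1 = 0%R.
Proof.
have := fM (carrier1 N) (carrier1 N); rewrite mulg1 => /(congr1 (fun a => a - f 1)%R).
by rewrite addrK subrr.
Qed.

Lemma add_onV u : carrier N u -> f u^-1 = (- f u)%R.
Proof.
move=> Nu; apply: (addrI (f u)); rewrite -fM ?mulgV ?add_on1 ?subrr //.
exact: carrierV.
Qed.

Lemma add_onJ u v : carrier N u -> carrier N v -> f (u ^ v) = f u.
Proof.
move=> Nu Nv; have NVv := carrierV Nv.
by rewrite conjgE !fM ?add_onV 1?addrCA ?addNr ?addr0 //; exact: carrierM.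
Qed.

Lemma carrierR u v : carrier N u -> carrier N [~ u, v].
Proof. by move=> Nu; apply: carrierM; [exact: carrierV|exact: nN]. Qed.

(** The condition at all conjugates, and not only at u, is what survives when a
    relator is conjugated by elements of G outside N. *)
Definition vanishing u := carrier N u /\ forall g, f (u ^ g) = 0%R.

Lemma vanishing1 : vanishing 1.
Proof. by split=> [|g]; [exact: carrier1|rewrite conj1g add_on1]. Qed.

Lemma vanishingM u v : vanishing u -> vanishing v -> vanishing (u * v).
Proof.
move=> [Nu fu] [Nv fv]; split=> [|g]; first exact: carrierM.
by rewrite conjMg fM ?fu ?fv ?addr0 //; exact: nN.
Qed.

Lemma vanishingV u : vanishing u -> vanishing u^-1.
Proof.
move=> [Nu fu]; split=> [|g]; first exact: carrierV.
by rewrite conjVg add_onV ?fu ?oppr0 //; exact: nN.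
Qed.

Lemma vanishing_comm u v : carrier N u -> carrier N v -> vanishing [~ u, v].
Proof.
move=> Nu Nv; split=> [|g]; first exact: carrierR.
have [NuJ NvJ] := (nN g Nu, nN g Nv).
rewrite conjRg commgEl fM ?(add_onJ NuJ NvJ) ?add_onV ?addNr //.
  exact: carrierV.
exact: nN.
Qed.

Lemma vanishing_prod (u v : nat -> G) m n :
  (forall i, (m <= i < n)%N -> carrier N (u i) /\ carrier N (v i)) ->
  vanishing (\prod_(m <= i < n) [~ u i, v i]).
Proof.
move=> Nuv; rewrite big_nat; apply: big_ind => [||i /Nuv[]].
- exact: vanishing1.
- exact: vanishingM.
- exact: vanishing_comm.
Qed.

Lemma vanishing_tail (s : seq G) k : odd (size s) ->
  (forall i, (k.*2 < i < size s)%N -> carrier N s`_i) ->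
  vanishing (\prod_(k <= i < (size s)./2) [~ s`_i.*2.+1, s`_i.*2.+2]).
Proof.
by move=> s_odd Ns; apply: vanishing_prod => i i_lt; split; apply: Ns; lia.
Qed.

(** Modulo vanishing elements z fixes x, hence so does y2, which agrees with z
    modulo N; therefore f takes the same value at all conjugates of [~ x, y1] by
    powers of y2. The first relation writes these values as successive
    differences of the sequence f (y3 ^ (y2 ^+ n)), whose terms at n = 0 and at
    n = p agree because y2 ^+ p is in N. *)
Lemma symplectic_torsion (p : nat) (x y1 y2 y3 z t1 t2 : G) :
  (forall g h, carrier N [~ g, h]) ->
  [~ x, y1] * ([~ y2, y3] * t1) = 1 -> [~ x, z] * t2 = 1 ->
  carrier N x -> carrier N y3 -> carrier N (z^-1 * y2) ->
  carrier N (y2 ^+ p) -> vanishing t1 -> vanishing t2 ->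
  (f [~ x, y1] *+ p = 0)%R.
Proof.
move=> NR r1 r2 Nx Ny3 Nzy Ny2p v1 v2.
have NJ u g : carrier N u -> carrier N (u ^ g) by exact: nN.
(* conjugation by an element of N is invisible to f *)
have fJ u h g : carrier N u -> carrier N h -> f (u ^ (h * g)) = f (u ^ g).
  by move=> Nu Nh; rewrite conjgM conjJg add_onJ //; exact: NJ.
have fz g : f (x ^ (z * g)) = f (x ^ g).
  rewrite conjgM; have -> : x ^ z = x * t2^-1.
    by rewrite -(mulKVg x (x ^ z)) -commgEl -(mulgK t2 [~ x, z]) r2 mul1g.
  have [Nt2 ft2] := vanishingV v2.
  by rewrite conjMg fM ?ft2 ?addr0 //; exact: NJ.
have fy g : f (x ^ (y2 * g)) = f (x ^ g).
  rewrite -{1}(mulKVg z y2) -mulgA fz.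
  by rewrite fJ.
have fyX n g : f (x ^ (y2 ^+ n * g)) = f (x ^ g).
  by elim: n g => [|n IH] g; rewrite ?mul1g // expgS -mulgA fy IH.
have fdiff u v g : carrier N u -> carrier N v ->
    f ((u^-1 * v) ^ g) = (- f (u ^ g) + f (v ^ g))%R.
  move=> Nu Nv; have [NuJ NvJ] := (NJ _ g Nu, NJ _ g Nv).
  by rewrite conjMg conjVg (fM (carrierV NuJ) NvJ) (add_onV NuJ).
(* w is [~ x, y1], in the form of a difference of two conjugates of x *)
pose w := x^-1 * x ^ y1; have Nw : carrier N w by exact: NR.
have fw n : f (w ^ (y2 ^+ n)) = f w.
  rewrite -[w in RHS]conjg1 !(fdiff x (x ^ y1)) //; try exact: NJ.
  congr (- _ + _)%R; first by rewrite -[_ ^+ n]mulg1 fyX.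
  by rewrite conjg1 -conjgM commgC conjgM add_onJ ?fyX //; exact: NJ.
have wE : w = t1^-1 * (y3^-1 * y3 ^ y2).
  apply: (mulIg ([~ y2, y3] * t1)); rewrite [LHS]r1.
  by rewrite -(commgEl y3 y2) -(invgR y2 y3) -mulgA mulKg mulVg.
have tel n : f (w ^ (y2 ^+ n)) = (f (y3 ^ (y2 ^+ n.+1)) - f (y3 ^ (y2 ^+ n)))%R.
  have [Nt1 ft1] := vanishingV v1.
  have Nd : carrier N (y3^-1 * y3 ^ y2) by exact: (carrierR y2 Ny3).
  rewrite wE conjMg (fM (NJ _ _ Nt1) (NJ _ _ Nd)) ft1 add0r.
  rewrite (fdiff y3 (y3 ^ y2)) //; last exact: NJ.
  by rewrite -conjgM -expgS addrC.
have : (\sum_(0 <= n < p) f (w ^ (y2 ^+ n)) = f w *+ p)%R.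
  by rewrite (eq_bigr (fun=> f w)) // big_const_nat subn0 iter_addr_0.
move=> <-; rewrite (eq_bigr (fun n => f (y3 ^ (y2 ^+ n.+1)) - f (y3 ^ (y2 ^+ n)))%R) //.
by rewrite telescope_sumr // conjg1 add_onJ ?subrr.
Qed.

(** Both u = z * y^-1 and u' = y^-1 * z are quotients of z by y. Modulo vanishing
    elements x multiplies y by y ^- p and z by z ^- p; these powers can be moved
    to the outside of u and of u', so that conjugation by x adds the same amount
    f (y ^+ p) - f (z ^+ p) to f u and to f u'. As x also acts by
    1 - p, f u *+ p and f u' *+ p are equal. *)
Lemma twisted_torsion (p : nat) (x y z t1 t2 : G) :
  y ^+ p * [~ y, x] * t1 = 1 -> z ^+ p * [~ z, x] * t2 = 1 ->
  (forall u, carrier N u -> f (u ^ x) = f u - f u *+ p)%R ->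
  carrier N (z * y^-1) -> carrier N (y ^+ p) -> carrier N (z ^+ p) ->
  vanishing t1 -> vanishing t2 ->
  (f [~ y^-1, z] *+ p = 0)%R.
Proof.
move=> r1 r2 fx Nu Ny Nz v1 v2.
have conj_gen (a t : G) : a ^+ p * [~ a, x] * t = 1 ->
    a ^ x = a * a ^- p * t^-1.
  move=> r; rewrite -(mulKVg a (a ^ x)) -commgEl -mulgA; congr (a * _).
  by apply: (mulgI (a ^+ p)); apply: (mulIg t); rewrite r mulKVg mulVg.
have Nu' : carrier N (y^-1 * z) by have := nN y Nu; rewrite conjgE mulgKV.
have [Nt1 ft1] := v1; have [Nt2 ft2] := v2.
have Xcomm (a : G) : a * a ^- p = a ^- p * a.
  exact/commuteV/commuteX/commute_refl.
have [NVz NVt2] := (carrierV Nz, carrierV Nt2).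
have ft0 t : vanishing t -> f t = 0%R by case=> _ /(_ 1); rewrite conjg1.
have cancel (a b c d : A) : (a - b = - c + (a + d) -> b = c - d)%R.
  move=> ab; rewrite -[b](subKr a) ab !opprD opprK addrCA; congr (_ + _)%R.
  by rewrite addrA subrr add0r.
have fu : (f (z * y^-1) *+ p)%R = (f (z ^+ p) - f (y ^+ p))%R.
  have vt : vanishing ((t2^-1 * t1) ^ z^-1).
    have [Nt ft] := vanishingM (vanishingV v2) v1.
    by split=> [|g]; [exact: nN|rewrite -conjgM ft].
  have : (z * y^-1) ^ x = z ^- p * (((t2^-1 * t1) ^ z^-1) * (z * y^-1 * y ^+ p)).
    rewrite conjMg conjVg (conj_gen _ _ r1) (conj_gen _ _ r2) Xcomm Xcomm.
    by rewrite !invMg !invgK conjgE invgK !mulgA !mulgKV.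
  have [Nt _] := vt; have NuY := carrierM Nu Ny.
  move/(congr1 f); rewrite (fx _ Nu) (fM NVz (carrierM Nt NuY)) (fM Nt NuY).
  by rewrite (fM Nu Ny) (add_onV Nz) (ft0 _ vt) add0r; exact: cancel.
have fu' : (f (y^-1 * z) *+ p)%R = (f (z ^+ p) - f (y ^+ p))%R.
  have : (y^-1 * z) ^ x = t1 * (y ^+ p * ((y^-1 * z) * z ^- p) * t2^-1).
    rewrite conjMg conjVg (conj_gen _ _ r1) (conj_gen _ _ r2).
    by rewrite !invMg !invgK !mulgA.
  have NuZ := carrierM Nu' NVz; have NYuZ := carrierM Ny NuZ.
  move/(congr1 f); rewrite (fx _ Nu') (fM Nt1 (carrierM NYuZ NVt2)).
  rewrite (fM NYuZ NVt2) (fM Ny NuZ) (fM Nu' NVz) (add_onV Nz) (add_onV Nt2).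
  rewrite (ft0 _ v1) (ft0 _ v2) oppr0.
  rewrite add0r addr0 => uE; apply: (cancel (f (y^-1 * z))).
  by rewrite uE addrA addrC [(f (y ^+ p) + _)%R]addrC.
have -> : [~ y^-1, z] = (z * y^-1)^-1 * (y^-1 * z).
  by rewrite invMg invgK /commg /conjg invgK mulgA.
by rewrite (fM (carrierV Nu) Nu') (add_onV Nu) mulrnDl mulNrn fu fu' addNr.
Qed.

End AdditiveOnNormal.

(** * Twisted cocycles on relators *)

(** Both families under one boolean, so that the cocycle computation, which
    differs by a single term and a sign, is done once. *)
Definition relator (b : bool) (p : nat) (F : groupType) (x : F) (y : seq F) : F :=
  if b then relator_b p x y else relator_a x y.

Section CocycleOnRelators.
Variables (G : groupType) (A : comPzRingType) (p : nat).
Local Open Scope ring_scope.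
Notation pi := (p%:R : A).
Hypothesis pi2 : pi * pi = 0.
Variables tau lambda : G -> A.
Hypothesis tauE : forall g, tau g = 1 + pi * lambda g.

Definition crossed (c : G -> A) := forall g h, c (g * h)%g = c g + tau g * c h.

(** The twist is invisible on multiples of p, so that a cocycle is additive where
    its values are such multiples. *)
Lemma pi_tau g a : pi * (tau g * a) = pi * a.
Proof.
have -> : pi * (tau g * a) = pi * a + pi * pi * (lambda g * a).
  by rewrite tauE; ring.
by rewrite pi2 mul0r addr0.
Qed.

Lemma tau_pi_inj g a b : tau g * a = pi * b -> a = pi * b.
Proof.
move=> ab; have pa : pi * a = 0 by rewrite -(pi_tau g) ab mulrA pi2 mul0r.
by rewrite -ab tauE mulrDl mul1r mulrAC pa mul0r addr0.
Qed.

Section OneCocycle.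
Variable c : G -> A.
Hypothesis cM : crossed c.

Lemma crossed1 : c 1%g = 0.
Proof.
rewrite -[RHS](mulr0 pi); apply: (@tau_pi_inj 1%g); rewrite mulr0.
by apply: (addrI (c 1%g)); rewrite -cM mulg1 addr0.
Qed.

Lemma crossed_comm g h : c [~ g, h]%g = pi * (lambda g * c h - lambda h * c g).
Proof.
apply: (@tau_pi_inj (h * g)%g); apply: (addrI (c (h * g)%g)).
rewrite -cM -commgC !cM !tauE. ring.
Qed.

Lemma crossed_pi u v a b :
  c u = pi * a -> c v = pi * b -> c (u * v)%g = pi * (a + b).
Proof. by move=> ua vb; rewrite cM ua vb mulrCA pi_tau mulrDr. Qed.

Lemma crossed_exp g n : c (g ^+ n)%g = (n%:R + pi * lambda g * 'C(n, 2)%:R) * c g.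
Proof.
elim: n => [|n IH]; first by rewrite crossed1 bin_small // mulr0 addr0 mul0r.
rewrite expgS cM IH tauE binS bin1 -addn1 !natrD.
transitivity ((n%:R + 1 + pi * lambda g * ('C(n, 2)%:R + n%:R)) * c g +
   pi * pi * (lambda g * lambda g * 'C(n, 2)%:R * c g)); first by ring.
rewrite pi2; ring.
Qed.

Lemma crossed_prod (u v : nat -> G) m n :
  c (\prod_(m <= i < n) [~ u i, v i])%g =
  pi * \sum_(m <= i < n) (lambda (u i) * c (v i) - lambda (v i) * c (u i)).
Proof.
apply: (big_ind2 (fun g a => c g = pi * a)); first by rewrite crossed1 mulr0.
- by move=> g a h b; exact: crossed_pi.
by move=> i _; exact: crossed_comm.
Qed.

(** For odd p the quadratic term of the p-th power, with coefficient
    p lambda(y_1) 'C(p, 2), is divisible by p^2 and drops out. *)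
Lemma crossed_relator (b : bool) x (y : seq G) : (b -> odd p) ->
  c (relator b p x y) = pi * (b%:R * c (y`_0)%g +
    (-1) ^+ b * (lambda x * c (y`_0)%g - lambda (y`_0)%g * c x) +
    \sum_(0 <= i < (size y)./2)
      (lambda (y`_i.*2.+1)%g * c (y`_i.*2.+2)%g -
       lambda (y`_i.*2.+2)%g * c (y`_i.*2.+1)%g)).
Proof.
rewrite /relator; case: b => [/(_ isT) p_odd|_].
  apply: crossed_pi; last exact: crossed_prod.
  apply: crossed_pi; last by rewrite crossed_comm expr1; congr (_ * _); ring.
  rewrite crossed_exp bin2odd // natrM mulrDl mul1r.
  have -> : pi * lambda (y`_0)%g * (pi * p.-1./2%:R) * c (y`_0)%g =
    pi * pi * (lambda (y`_0)%g * p.-1./2%:R * c (y`_0)%g) by ring.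
  by rewrite pi2 mul0r addr0.
apply: crossed_pi; last exact: crossed_prod.
by rewrite crossed_comm mul0r add0r expr0 mul1r.
Qed.

End OneCocycle.

(** In the value of a cocycle on the relator each generator is paired with one
    other: x with y_1, and y_2k with y_(2k+1). Testing against cocycles that are
    1 mod p on one generator and 0 mod p on the others isolates the value of
    lambda on its partner. *)
Lemma relator_orientation (b : bool) x (y : seq G) : (b -> odd p) -> odd (size y) ->
  relator b p x y = 1%g ->
  (forall (e : bool) (d : nat -> bool), exists c, [/\ crossed c,
     pi * c x = pi * e%:R &
     forall i, (i < size y)%N -> pi * c (y`_i)%g = pi * (d i)%:R]) ->
  tau x = 1 + pi *+ b /\ forall i, (i < size y)%N -> tau (y`_i)%g = 1.
Proof.
move=> p_odd y_odd r1 lift.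
have half_lt i : (i < (size y)./2)%N -> (i.*2.+2 < size y)%N.
  by lia.
have key (e : bool) (d : nat -> bool) :
    pi * (b%:R * (d 0%N)%:R +
     (-1) ^+ b * (lambda x * (d 0%N)%:R - lambda (y`_0)%g * e%:R) +
     \sum_(0 <= i < (size y)./2) (lambda (y`_i.*2.+1)%g * (d i.*2.+2)%:R -
        lambda (y`_i.*2.+2)%g * (d i.*2.+1)%:R)) = 0.
  have [c [cM cx cy]] := lift e d.
  have := crossed_relator cM x y p_odd; rewrite r1 (crossed1 cM) => c0.
  rewrite [RHS]c0.
  have y0 : (0 < size y)%N by case: (size y) y_odd.
  have piC k a a' : pi * a = pi * a' -> pi * (k * a) = pi * (k * a').
    by move=> aa; rewrite mulrCA aa mulrCA.
  rewrite !(mulrDr, mulrN); congr (_ + _ + _).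
  - exact/piC/esym/cy.
  - by congr (_ + _); [exact/piC/piC/esym/cy |congr (- _); exact/piC/piC/esym].
  rewrite !mulr_sumr !big_nat; apply: eq_bigr => i /half_lt i_lt.
  by rewrite !mulrBr; congr (_ - _); apply/piC/esym/cy => //; exact: ltnW.
have sum0 (F : nat -> A) n : (forall i, (i < n)%N -> F i = 0) ->
    \sum_(0 <= i < n) F i = 0.
  by move=> F0; rewrite big_nat big1.
have sum1 (F : nat -> A) n k : (k < n)%N ->
    (forall i, (i < n)%N -> i != k -> F i = 0) -> \sum_(0 <= i < n) F i = F k.
  move=> kn F0; rewrite big_mkord (bigD1 (Ordinal kn)) //= big1 ?addr0 //.
  by move=> i ik; apply: F0.
split.
  have := key false (eq_op^~ 0%N).
  rewrite sum0 => [|i _]; last by rewrite /= !mulr0 subrr.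
  case: (b) => /= H; rewrite tauE.
    by apply/eqP; rewrite -subr_eq0 -oppr_eq0; apply/eqP; rewrite -[RHS]H; ring.
  by rewrite mulr0n -[RHS]addr0 -[X in _ = _ + X]H; ring.
move=> [|k] k_lt; rewrite tauE -[RHS]addr0; congr (_ + _).
  have := key true (fun=> false).
  rewrite sum0 => [|i _]; last by rewrite /= !mulr0 subrr.
  case: (b) => /= H; first by rewrite -[RHS]H; ring.
  by apply/eqP; rewrite -oppr_eq0; apply/eqP; rewrite -[RHS]H; ring.
have hk : (k./2 < (size y)./2)%N by lia.
(* testing against the class that is dual to the symplectic partner of y_k *)
(* the partner of the generator with index k.+1 has index k or k.+2 *)
case/boolP: (odd k) => k_odd.
  have kE : k = k./2.*2.+1 by lia.
  have := key false (eq_op^~ k).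
  have -> : (0%N == k) = false by lia.
  rewrite (@sum1 _ _ _ hk) => [|i _ ik]; last first.
    have [-> ->] : (i.*2.+1 == k) = false /\ (i.*2.+2 == k) = false by lia.
    by rewrite !mulr0 subrr.
  have [-> ->] : (k./2.*2.+1 == k) = true /\ (k./2.*2.+2 == k) = false by lia.
  have -> : k./2.*2.+2 = k.+1 by lia.
  by move=> H; apply/eqP; rewrite -oppr_eq0; apply/eqP; rewrite -[RHS]H /=; ring.
have := key false (eq_op^~ k.+2).
have -> : (0%N == k.+2) = false by lia.
rewrite (@sum1 _ _ _ hk) => [|i _ ik]; last first.
  have [-> ->] : (i.*2.+1 == k.+2) = false /\ (i.*2.+2 == k.+2) = false by lia.
  by rewrite !mulr0 subrr.
have [-> ->] : (k./2.*2.+1 == k.+2) = false /\ (k./2.*2.+2 == k.+2) = true by lia.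
have -> : k./2.*2.+1 = k.+1 by lia.
by move=> H; rewrite -[RHS]H /=; ring.
Qed.

End CocycleOnRelators.

(** * Generators and relators of G *)

Lemma nth_hom (F H : groupType) (h : F -> H) (s : seq F) i :
  h 1%g = 1%g -> ((map h s)`_i)%g = h (s`_i)%g.
Proof.
move=> h1; have [i_lt|i_ge] := ltnP i (size s); first exact: nth_map.
by rewrite !nth_default ?size_map.
Qed.

Lemma relator_natural b p (F H : groupType) (h : F -> H) x (y : seq F) :
  {morph h : u v / (u * v)%g} ->
  relator b p (h x) (map h y) = h (relator b p x y).
Proof.
move=> hM; have h1 := hom1 hM.
have tail : commutator_tail (map h y) = h (commutator_tail y).
  rewrite /commutator_tail size_map (big_morph h hM h1).
  by apply: eq_bigr => i _; rewrite !nth_hom // (homR hM).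
rewrite /relator /relator_a /relator_b tail !nth_hom //.
case: b; first by rewrite hM (hM (_ ^+ p)%g) (homX hM) (homR hM).
by rewrite hM (homR hM).
Qed.

(** What is used of the presentation: the relations, and enough homomorphisms to
    finite p-groups. In this form the exchange of y and z is a symmetry. *)
Definition presented (b : bool) (p : nat) (G : topGroupType) (x : G)
    (y z : seq G) : Prop :=
  [/\ relator b p x y = 1%g, relator b p x z = 1%g
    & forall (Q : finGroupType) (q : Q) (v w : nat -> Q), (p.-nat #|Q|)%N ->
        relator b p q (mkseq v (size y)) = 1%g ->
        relator b p q (mkseq w (size z)) = 1%g ->
        exists phi : G -> discrete_group Q, [/\ continuous_hom phi, phi x = q,
          forall i, (i < size y)%N -> phi (y`_i)%g = v i
        & forall i, (i < size z)%N -> phi (z`_i)%g = w i]].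

Lemma presented_sym b p (G : topGroupType) (x : G) y z :
  presented b p x y z -> presented b p x z y.
Proof.
move=> [ry rz univ]; split=> // Q q v w pQ rv rw.
by have [phi [? ? ? ?]] := univ Q q w v pQ rw rv; exists phi.
Qed.

Definition relators (b : bool) (p d1 d2 : nat) (F : groupType)
    (g : gens d1 d2 -> F) : set F :=
  [set relator b p (xgen g) (ygens g); relator b p (xgen g) (zgens g)].

Lemma relators_natural b p d1 d2 (F H : groupType) (h : F -> H)
    (g : gens d1 d2 -> F) :
  {morph h : u v / (u * v)%g} ->
  relators b p (h \o g) = h @` relators b p g.
Proof.
move=> hM; rewrite /relators image_setU !image_set1 -!(relator_natural _ _ _ _ hM).
by rewrite /ygens /zgens -!map_comp.
Qed.

Lemma presentation_presented (b : bool) (p d1 d2 : nat) (G : topGroupType) :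
  prime p -> has_pro_p_presentation p (@relators b p d1 d2) G ->
  exists (x : G) (y z : seq G),
    [/\ presented b p x y z, size y = d1 & size z = d2].
Proof.
move=> p_pr /(presentation_hom (@relators_natural b p d1 d2)) [g [rg univ]].
have gens_nth d (X : groupType) (f : 'I_d -> X) i (i_lt : (i < d)%N) :
    ([seq f j | j <- enum 'I_d]`_i)%g = f (Ordinal i_lt).
  rewrite (nth_map (Ordinal i_lt)) ?size_enum_ord //; congr f.
  by apply: val_inj; rewrite /= nth_enum_ord.
have gens_mkseq d (X : Type) (f : nat -> X) :
    [seq f (val j) | j <- enum 'I_d] = mkseq f d.
  by rewrite -[mkseq f d]/(map f (iota 0 d)) -val_enum_ord -map_comp.
exists (xgen g), (ygens g), (zgens g).
have [sy sz] : size (ygens g) = d1 /\ size (zgens g) = d2.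
  by split; rewrite size_map size_enum_ord.
split=> //; split; [by apply: rg; left|by apply: rg; right|].
move=> Q q v w pQ; rewrite sy sz => rv rw.
pose f (i : gens d1 d2) : discrete_group Q :=
  match i with None => q | Some (inl j) => v (val j) | Some (inr j) => w (val j) end.
have [|phi [phi_hom phi_g]] := univ _ f (pgroup_pro_p p_pr pQ).
  by move=> _ [->|->] /=; rewrite /ygens /zgens /= gens_mkseq.
exists phi; split=> // [|i i_lt|i i_lt]; first by rewrite /xgen phi_g.
  by rewrite gens_nth phi_g.
by rewrite gens_nth phi_g.
Qed.

(** * Consequences of the Kummerian property *)

Section Lifting.
Variables (p : nat) (G : topGroupType) (theta : orientation p G).
Hypothesis p_pr : prime p.
Local Open Scope ring_scope.

(** The Kummerian property mod p^2 in terms of cocycles: as F_p is a trivial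
    module, cohomologous characters are equal, so that a character itself
    lifts, and not only its class. Everything is stated with functions on G to
    avoid the subtype carried by H. *)
Lemma kummer_lift (H : subgroup G) (chi : G -> 'F_p) :
  one_cyclotomic theta -> closed H ->
  continuous (chi : G -> discrete_topology 'F_p) ->
  (forall g h, carrier H g -> carrier H h -> chi (g * h)%g = chi g + chi h) ->
  exists f : G -> 'Z_(p ^ 2),
    (forall g h, carrier H g -> carrier H h ->
       f (g * h)%g = f g + padic_red 2 (theta g) * f h) /\
    forall g, carrier H g -> mod_p (f g) = chi g.
Proof.
move=> cyc H_closed chi_cont chiM.
pose chiH (g : set_type (carrier H)) : 'F_p := chi (set_val g).
have chiH_cocycle : cocycle (@trivial_act (set_type (carrier H)) 'F_p) chiH.
  split; last by move=> g h; rewrite /chiH /trivial_act chiM //; exact: carrier_val.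
  move=> g; apply: (@continuous_comp _ _ _ set_val (chi : G -> discrete_topology 'F_p)).
    exact: initial_continuous.
  exact: chi_cont.
have [|_ [c c_cocycle <-]] := cyc H H_closed 2%N isT (cohomology_class (@trivial_act _ _) chiH).
  by exists chiH.
rewrite H1_mapE //; last 3 first.
- exact: twist_actD.
- exact: mod_pD.
- exact: mod_p_act.
have class_self : cohomology_class (@trivial_act (set_type (carrier H)) 'F_p) chiH chiH.
  by split=> //; exists 0 => g; rewrite !subrr.
move=> /seteqP[_ /(_ _ class_self) [_ [m chi_c]]].
pose f (g : G) : 'Z_(p ^ 2) := if pselect (carrier H g) is left Hg
  then c (SigSub (mem_set Hg)) else 0.
have fE (g : set_type (carrier H)) : f (set_val g) = c g.
  rewrite /f; case: pselect => [Hg|/(_ (carrier_val g))//].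
  by congr c; apply: val_inj.
exists f; split=> [g h Hg Hh|g Hg].
  pose g' : set_type (carrier H) := SigSub (mem_set Hg).
  pose h' : set_type (carrier H) := SigSub (mem_set Hh).
  rewrite (fE (g' * h')%g : f (g * h)%g = _) (fE g' : f g = _) (fE h' : f h = _).
  exact: c_cocycle.2.
pose g' : set_type (carrier H) := SigSub (mem_set Hg).
rewrite (fE g' : f g = _); apply/esym/subr0_eq.
by have := chi_c g'; rewrite subrr.
Qed.

End Lifting.

Section Orientation.
Variables (p : nat) (G : topGroupType) (theta : orientation p G).
Hypothesis p_pr : prime p.
Local Open Scope ring_scope.
Local Notation Zp2 := 'Z_(p ^ 2).

Let p2_gt1 : (1 < p ^ 2)%N.
Proof. by rewrite (ltn_exp2l 0) ?prime_gt1. Qed.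

Lemma natr_p2 : p%:R * p%:R = 0 :> Zp2.
Proof. by rewrite -natrM mulnn (pchar_Zp p2_gt1). Qed.

Lemma mulp_eq0 (a : Zp2) : (p%:R * a == 0) = (mod_p a == 0).
Proof.
rewrite /mod_p -[a in LHS]natr_Zp -natrM -!val_eqE /=.
rewrite [X in X == _](val_Zp_nat p2_gt1) [X in _ = (X == _)](val_Fp_nat p_pr).
by have := @dvdn_pmul2l p p a (prime_gt0 p_pr); rewrite mulnn.
Qed.

Lemma mulp_congr (a b : Zp2) : mod_p a = mod_p b -> p%:R * a = p%:R * b.
Proof.
move=> ab; apply/eqP; rewrite -subr_eq0 -mulrBr mulp_eq0.
have := mod_pD p_pr (isT : (0 < 2)%N) (a - b) b; rewrite subrK ab.
by rewrite -[X in X = _]add0r => /addIr <-.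
Qed.

Definition tau (g : G) : Zp2 := padic_red 2 (theta g).

Lemma tauM g h : tau (g * h)%g = tau g * tau h.
Proof. by rewrite /tau orientM padic_redM ?prime_gt1. Qed.

Lemma tau_unit g : exists l, tau g = 1 + p%:R * l.
Proof.
rewrite /tau; have [l _ <-] := orient_unit theta g; exists (padic_red 2 l).
rewrite padic_redD ?padic_red1 ?padic_redM ?prime_gt1 //; congr (_ + _ * _).
by rewrite /padic_red res_natr intr_modz ?prime_gt1.
Qed.

Lemma relator_commuting (b : bool) (F : groupType) (x : F) y :
  (forall u v : F, commute u v) -> relator b p x y = (if b then (y`_0 ^+ p)%g else 1%g).
Proof.
move=> comm; have R1 (u v : F) : [~ u, v]%g = 1%g by apply/eqP/commgP.
have T1 : commutator_tail y = 1%g by rewrite /commutator_tail big1.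
by rewrite /relator /relator_a /relator_b T1 !R1 !mulg1; case: b.
Qed.

Definition full_subgroup : subgroup G :=
  @Subgroup G setT I (fun _ _ _ _ => I) (fun _ _ => I).

(** The additive group of F_p is abelian of exponent p, so that the generators
    of G can be sent to arbitrary elements of it; the cocycles that lift the
    resulting characters are those needed to determine tau. *)
Lemma orientation_values (b : bool) (x : G) (y z : seq G) :
  (b -> odd p) -> odd (size y) -> presented b p x y z -> one_cyclotomic theta ->
  tau x = 1 + p%:R *+ b /\ forall i, (i < size y)%N -> tau (y`_i)%g = 1.
Proof.
move=> p_odd y_odd [ry _ univ] cyc.
have [lambda tauE] := choice tau_unit.
apply: (relator_orientation natr_p2 tauE p_odd y_odd ry) => e d.
have FpC (u v : 'F_p) : commute u v by rewrite /commute /mulg /= addrC.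
have FpX (u : 'F_p) : (u ^+ p)%g = 1%g.
  by rewrite FinRing.zmodXgE -mulr_natr (pchar_Fp_0 p_pr) mulr0.
have Fp_rel (q : 'F_p) (s : seq 'F_p) : relator b p q s = 1%g.
  by rewrite relator_commuting // FpX if_same.
have [|phi [[phi_cont phiM] phix phiy _]] :=
  univ 'F_p e%:R (fun i => (d i)%:R) (fun=> 0) _ (Fp_rel _ _) (Fp_rel _ _).
  by rewrite card_Fp // pnat_id.
have [||c [cM c_phi]] := @kummer_lift p G theta p_pr full_subgroup phi cyc _ phi_cont.
- exact: closedT.
- by move=> g h _ _; exact: phiM.
have test g (k : bool) : phi g = k%:R -> p%:R * c g = p%:R * k%:R.
  by move=> gk; apply: mulp_congr; rewrite c_phi // gk mod_p_natr.
exists c; split=> [g h||i i_lt]; first exact: cM.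
  exact: test.
by apply: test; exact: phiy.
Qed.

End Orientation.

(** * Lifts of the Heisenberg character *)

Section HeisenbergTest.
Variables (p : nat) (G : topGroupType) (theta : orientation p G).
Hypothesis p_pr : prime p.
Local Open Scope ring_scope.
Local Notation Heis := (heis 'F_p).
Local Notation tau := (tau theta).
Variable phi : G -> discrete_group Heis.
Hypothesis phi_hom : continuous_hom phi.

Let phiM : {morph phi : g h / (g * h)%g} := phi_hom.2.

Definition beta (g : G) : 'F_p * 'F_p := (phi g : Heis).1.2.

Lemma betaM g h : beta (g * h)%g = beta g + beta h.
Proof. by rewrite /beta phiM. Qed.

Lemma beta1 : beta 1%g = 0.
Proof. by rewrite /beta (hom1 phiM). Qed.

Lemma betaV g : beta g^-1%g = - beta g.
Proof. by rewrite /beta (homV phiM). Qed.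

Fact beta_kerM g h : beta g = 0 -> beta h = 0 -> beta (g * h)%g = 0.
Proof. by move=> g0 h0; rewrite betaM g0 h0 addr0. Qed.

Fact beta_kerV g : beta g = 0 -> beta g^-1%g = 0.
Proof. by move=> g0; rewrite betaV g0 oppr0. Qed.

(** The image of this subgroup in the Heisenberg group is abelian and the
    central coordinate is additive on it; so it carries a character to F_p that
    does not kill the commutators of G. *)
Definition beta_ker : subgroup G :=
  @Subgroup G [set g | beta g = 0] beta1 beta_kerM beta_kerV.

Lemma tau1 : tau 1%g = 1.
Proof.
by have := twist_act1 theta p_pr (isT : (0 < 2)%N) 1; rewrite /twist_act mulr1.
Qed.

Lemma tauV g : tau g = 1 -> tau g^-1%g = 1.
Proof. by move=> g1; rewrite -tau1 -(mulgV g) tauM // g1 mul1r. Qed.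

(** On these elements the twisted lifts of a character are additive. They are
    the kernel of a map to an abelian group, hence contain all commutators. *)
Definition inert (g : G) := beta g = 0 /\ tau g = 1.

Fact inert1 : inert 1%g.
Proof. by split; [exact: beta1|exact: tau1]. Qed.

Fact inertM g h : inert g -> inert h -> inert (g * h)%g.
Proof.
by move=> [g0 g1] [h0 h1]; split; [exact: beta_kerM|rewrite tauM // g1 h1 mulr1].
Qed.

Fact inertV g : inert g -> inert g^-1%g.
Proof. by move=> [g0 g1]; split; [exact: beta_kerV|exact: tauV]. Qed.

Definition inert_subgroup : subgroup G :=
  @Subgroup G inert inert1 inertM inertV.

Lemma inert_normal : normal_subgroup inert_subgroup.
Proof.
move=> g h [g0 g1]; split; first by rewrite conjgE !betaM betaV g0 add0r addNr.
by rewrite conjgE !tauM // g1 mul1r -tauM // mulVg tau1.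
Qed.

Lemma inert_comm g h : inert [~ g, h]%g.
Proof.
split; first by rewrite /commg /conjg !betaM !betaV [_ + beta h]addrC addKr addNr.
have tauVM k : tau k^-1%g * tau k = 1 by rewrite -tauM // mulVg tau1.
rewrite /commg /conjg !tauM // -[RHS](mulr1 1) -{1}(tauVM g) -(tauVM h); ring.
Qed.

Lemma Fp_mulp (u : 'F_p) : u *+ p = 0.
Proof. by rewrite -mulr_natr (pchar_Fp_0 p_pr) mulr0. Qed.

Lemma inert_exp g : tau g = 1 -> inert (g ^+ p)%g.
Proof.
move=> g1; have tauX n : tau (g ^+ n)%g = 1.
  by elim: n => [|n IH]; rewrite ?tau1 // expgS tauM // g1 mul1r.
have betaX n : beta (g ^+ n)%g = beta g *+ n.
  by elim: n => [|n IH]; rewrite ?beta1 // expgS betaM IH mulrS.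
split; last exact: tauX.
by rewrite betaX pairMnE !Fp_mulp.
Qed.

(** The lift f of the central coordinate given by the Kummerian property. The
    last clause is the obstruction used below: an element on which f has order
    dividing p has trivial central coordinate, because multiplication by p
    identifies F_p with the p-torsion of Z/p^2. *)
Lemma heis_lift : one_cyclotomic theta -> exists f : G -> 'Z_(p ^ 2),
  [/\ forall u v, inert u -> inert v -> f (u * v)%g = f u + f v,
      forall u x, inert u -> beta x = 0 -> tau x * f (u ^ x)%g = f u
    & forall g, beta g = 0 -> f g *+ p = 0 -> (phi g : Heis).2 = 0].
Proof.
move=> cyc; have [phi_cont _] := phi_hom.
pose chi g : 'F_p := (phi g : Heis).2.
have [|||f [fM f_chi]] := @kummer_lift p G theta p_pr beta_ker chi cyc.
- exact: (closed_preimage_discrete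
    (A := [set u : discrete_group Heis | (u : Heis).1.2 = 0])).
- move=> g; apply: (@continuous_comp _ _ _ phi
    (fun u : discrete_group Heis => (u : Heis).2 : discrete_topology 'F_p)).
    exact: phi_cont.
  exact: discrete_continuous.
- move=> g h _ h0; rewrite /chi phiM heis_mulE /heis_mul /=.
  by move: h0; rewrite /= /beta => ->; rewrite dot0r addr0.
have {}fM g h : beta g = 0 -> beta h = 0 -> f (g * h)%g = f g + tau g * f h.
  exact: fM.
exists f; split=> [u v [u0 u1] [v0 _]|u x [u0 u1] x0|g g0 pf0].
- by rewrite fM // u1 mul1r.
- have ux0 : beta (u ^ x)%g = 0.
    by rewrite conjgE; apply: beta_kerM; [exact: beta_kerV|exact: beta_kerM].
  apply: (addrI (f x)); rewrite -(fM x) // -(conjgC u x) (fM u) // u1 mul1r.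
  exact: addrC.
rewrite -[LHS]f_chi //.
by apply/eqP; rewrite -mulp_eq0 // mulr_natl pf0.
Qed.

End HeisenbergTest.

(** * The two families of groups *)

Section NotCyclotomic.
Variables (p : nat) (G : topGroupType) (theta : orientation p G).
Hypothesis p_pr : prime p.
Local Open Scope ring_scope.
Local Notation Heis := (heis 'F_p).

Lemma pnat_heis : (p.-nat #|{: Heis}|)%N.
Proof. by rewrite card_heis card_Fp // pnatX pnat_id. Qed.

Lemma heis_exp_p (g : Heis) : odd p -> (g ^+ p)%g = 1%g.
Proof.
move=> p_odd; case: g => [[a b] c]; rewrite heis_expE bin2odd // mulrnA !pairMnE.
by rewrite !Fp_mulp // mul0rn addr0.
Qed.

Lemma big_comm1 (F : groupType) (u v : nat -> F) m n :
  (forall i, (m <= i < n)%N -> u i = 1%g) ->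
  (\prod_(m <= i < n) [~ u i, v i])%g = 1%g.
Proof. by move=> u1; rewrite big_nat big1 // => i /u1 ->; rewrite comm1g. Qed.

Lemma not_cyclotomic_a (x : G) (y z : seq G) :
  odd (size y) -> odd (size z) -> (2 < size y)%N ->
  presented false p x y z -> ~ one_cyclotomic theta.
Proof.
move=> y_odd z_odd y_gt2 pres cyc; have [ry rz univ] := pres.
have b_odd : false -> odd p by [].
have [tx ty] := orientation_values p_pr b_odd y_odd pres cyc.
have [_ tz] := orientation_values p_pr b_odd z_odd (presented_sym pres) cyc.
rewrite mulr0n addr0 in tx.
(* [x, y_1] and [y_2, y_3] map to opposite central elements, and z_1 has the
   image of y_2, which commutes with the image of x *)
pose q : Heis := ((1, 0), 0, 0).
pose v (i : nat) : Heis := match i with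
  | 0 => (0, (1, 0), 0) | 1 => (0, (0, 1), 0) | 2 => ((0, 1), 0, 0)
  | _ => 1%g end.
pose w (i : nat) : Heis := if i is 0 then (0, (0, 1), 0) else 1%g.
have half_gt0 : (0 < (size y)./2)%N by lia.
have rv : relator false p q (mkseq v (size y)) = 1%g.
  rewrite /= /relator_a /commutator_tail size_mkseq (big_ltn half_gt0) big_comm1.
    rewrite !nth_mkseq ?mulg1 // ?(ltn_trans _ y_gt2) //= !heis_commE heis_mulE.
    by rewrite /heis_mul /dot /=; congr (_, _, _); rewrite /=; ring.
  move=> i i_lt; rewrite nth_mkseq; last by lia.
  by case: i i_lt.
have rw : relator false p q (mkseq w (size z)) = 1%g.
  rewrite /= /relator_a /commutator_tail big_comm1; last first.
    by move=> i; rewrite size_mkseq => i_lt; rewrite nth_mkseq //; lia.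
  rewrite nth_mkseq ?mulg1; last by lia.
  by rewrite heis_commE /dot /=; congr (_, _, _); rewrite /=; ring.
have [phi [phi_hom phix phiy phiz]] := univ _ q v w pnat_heis rv rw.
have [f [fM _ f_phi]] := heis_lift p_pr phi_hom cyc.
have nN : normal_subgroup (inert_subgroup theta p_pr phi_hom).
  exact: inert_normal.
have y_lt i : (i < 3)%N -> (i < size y)%N by lia.
have z_gt0 : (0 < size z)%N by lia.
have wE : phi [~ x, y`_0]%g = (0, 0, 1) :> Heis.
  rewrite (homR phi_hom.2) phix phiy ?y_lt // heis_commE /dot /=.
  by congr (_, _, _); rewrite /=; ring.
suff : (phi [~ x, y`_0]%g : Heis).2 = 0 by rewrite wE => /eqP; rewrite oner_eq0.
apply: f_phi; first by have [] := inert_comm theta p_pr phi_hom x (y`_0)%g.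
apply: (symplectic_torsion nN fM (y2 := (y`_1)%g) (y3 := (y`_2)%g)
  (z := (z`_0)%g)
  (t1 := (\prod_(1 <= i < (size y)./2) [~ y`_i.*2.+1, y`_i.*2.+2])%g)
  (t2 := commutator_tail z)).
- exact: inert_comm.
- by move: ry; rewrite /= /relator_a /commutator_tail (big_ltn half_gt0).
- exact: rz.
- by split=> //; rewrite /beta phix.
- by split; [rewrite /beta phiy ?y_lt | apply: ty; exact: y_lt].
- split; last by rewrite tauM // ty ?y_lt // mulr1 tauV // tz.
  by rewrite betaM // betaV // /beta phiz // phiy ?y_lt //= addNr.
- by apply: inert_exp => //; apply: ty; exact: y_lt.
- apply: vanishing_tail => // i /andP[i_gt i_lt]; split; last exact: ty.
  by rewrite /beta phiy //; case: i i_gt i_lt => [|[|[|]]].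
- apply: vanishing_tail => // i /andP[i_gt i_lt]; split; last exact: tz.
  by rewrite /beta phiz //; case: i i_gt i_lt.
Qed.

Lemma not_cyclotomic_b (x : G) (y z : seq G) :
  odd p -> odd (size y) -> odd (size z) ->
  presented true p x y z -> ~ one_cyclotomic theta.
Proof.
move=> p_odd y_odd z_odd pres cyc; have [ry rz univ] := pres.
have b_odd : true -> odd p by [].
have [tx ty] := orientation_values p_pr b_odd y_odd pres cyc.
have [_ tz] := orientation_values p_pr b_odd z_odd (presented_sym pres) cyc.
rewrite mulr1n in tx.
(* y_1 and z_1 have the same second coordinate but do not commute, and x maps
   to 1, so that the relators become the p-th powers of y_1 and z_1 *)
pose v (i : nat) : Heis := if i is 0 then (0, (1, 0), 0) else 1%g.
pose w (i : nat) : Heis := if i is 0 then ((1, 0), (1, 0), 0) else 1%g.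
have rel1 (u : nat -> Heis) d : odd d -> (forall i, u i.+1 = 1%g) ->
    relator true p (1%g : Heis) (mkseq u d) = 1%g.
  move=> d_odd u1; rewrite /= /relator_b /commutator_tail big_comm1; last first.
    by move=> i; rewrite size_mkseq => i_lt; rewrite nth_mkseq //; lia.
  by rewrite heis_exp_p // commg1 !mulg1.
have [phi [phi_hom phix phiy phiz]] := univ _ 1%g v w pnat_heis
  (rel1 v _ y_odd (fun=> erefl)) (rel1 w _ z_odd (fun=> erefl)).
have [f [fM fJ f_phi]] := heis_lift p_pr phi_hom cyc.
have nN : normal_subgroup (inert_subgroup theta p_pr phi_hom).
  exact: inert_normal.
have y_gt0 : (0 < size y)%N by lia.
have z_gt0 : (0 < size z)%N by lia.
have wE : phi [~ (y`_0)^-1, z`_0]%g = (0, 0, 1) :> Heis.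
  rewrite (homR phi_hom.2) (homV phi_hom.2) phiy // phiz // heis_commE /dot /=.
  by congr (_, _, _); rewrite /=; ring.
suff : (phi [~ (y`_0)^-1, z`_0]%g : Heis).2 = 0.
  by rewrite wE => /eqP; rewrite oner_eq0.
apply: f_phi.
  by have [] := inert_comm theta p_pr phi_hom ((y`_0)^-1)%g (z`_0)%g.
apply: (twisted_torsion nN fM (x := x) (t1 := commutator_tail y)
  (t2 := commutator_tail z)) => //.
- move=> u /fJ /(_ (_ : beta phi x = 0)); rewrite tx => <-; last first.
    by rewrite /beta phix.
  set a := f _; transitivity (a - p%:R * p%:R * a); last by ring.
  by rewrite natr_p2 // mul0r subr0.
- split; last by rewrite tauM // tz // mul1r tauV // ty.
  by rewrite betaM // betaV // /beta phiz // phiy //= subrr.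
- by apply: inert_exp => //; exact: ty.
- by apply: inert_exp => //; exact: tz.
- apply: vanishing_tail => // i /andP[i_gt i_lt]; split; last exact: ty.
  by rewrite /beta phiy //; case: i i_gt i_lt.
- apply: vanishing_tail => // i /andP[i_gt i_lt]; split; last exact: tz.
  by rewrite /beta phiz //; case: i i_gt i_lt.
Qed.

End NotCyclotomic.

Theorem theorem1p1 (p d1 d2 : nat) (G : topGroupType)
  (p_prime : prime p) (d1_odd : odd d1) (d2_odd : odd d2)
  (G_pres :
     (4 <= d1 + d2 /\ has_pro_p_presentation p (relators_a d1 d2) G) \/
     (odd p /\ has_pro_p_presentation p (relators_b p d1 d2) G)) :
  ~ exists theta : orientation p G, one_cyclotomic theta.
Proof.
move=> [theta cyc]; case: G_pres => [[d_ge4 pres]|[p_odd pres]].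
  have [x [y [z [Gp sy sz]]]] :=
    @presentation_presented false p d1 d2 G p_prime pres.
  (* the argument needs y_2 and y_3; the presentation is symmetric in y and z *)
  have [y_gt2|z_gt2] : (2 < size y)%N \/ (2 < size z)%N by lia.
    by apply: (not_cyclotomic_a p_prime _ _ y_gt2 Gp cyc); rewrite ?sy ?sz.
  by apply: (not_cyclotomic_a p_prime _ _ z_gt2 (presented_sym Gp) cyc);
    rewrite ?sy ?sz.
have [x [y [z [Gp sy sz]]]] :=
  @presentation_presented true p d1 d2 G p_prime pres.
by apply: (not_cyclotomic_b p_prime p_odd _ _ Gp cyc); rewrite ?sy ?sz.
Qed.
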